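(* Let $R$ be a nonzero associative unital ring, $n$ a positive integer, $G$ a group with identity element $e$, and $\rho$ an equivalence relation on $\overline{n}=\{1,\ldots,n\}$. Let $\mathcal{S}=(S_g)_{g\in G}\in\mathcal{G}(\rho,G,R)$ and let $\Phi(\mathcal{S})\in\mathcal{A}(\rho,G)$ be the corresponding partial action. Then the $G$-grading $\mathcal{S}$ on $M_n(\rho,R)$ is strong if and only if the partial action $\Phi(\mathcal{S})$ is global.
   Context: Gradings. For $X,Y\subseteq\overline{n}\times\overline{n}$ put $XY=\{(i,k)\mid \exists j\in\overline{n}:\ (i,j)\in X,\ (j,k)\in Y\}$. A $G$-grading on $\rho$ is a family $(\rho_g)_{g\in G}$ of pairwise disjoint (possibly empty) subsets of $\rho$ with $\rho=\bigcup_{g\in G}\rho_g$ and $\rho_g\rho_h\subseteq\rho_{gh}$ for all $g,h\in G$. Let $e_{i,j}$ be the matrix with $1$ in position $(i,j)$ and zeros elsewhere, and $M_n(\rho,R)=\sum_{(i,j)\in\rho}Re_{i,j}\subseteq M_n(R)$. A $G$-grading $(S_g)_{g\in G}$ on $M_n(\rho,R)$ is very good if there is a $G$-grading $(\rho_g)_{g\in G}$ on $\rho$ with $S_g=\sum_{(i,j)\in\rho_g}Re_{i,j}$ for all $g\in G$. $\mathcal{G}(\rho,G,R)$ is the set of all very good $G$-gradings $(S_g)_{g\in G}$ on $M_n(\rho,R)$ with $S_e=\bigoplus_{i=1}^nRe_{i,i}$. A grading $(S_g)_{g\in G}$ is strong if $S_gS_{g^{-1}}=S_e$ for every $g\in G$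 (the product being the additive subgroup generated by products). Partial actions. A partial action of $G$ on a set $X$ is a family $\alpha=(X_g,\alpha_g)_{g\in G}$, where $X_g\subseteq X$ and $\alpha_g:X_{g^{-1}}\to X_g$ is a bijection for every $g\in G$, such that (P1) $X_e=X$ and $\alpha_e=\mathrm{id}_X$; (P2) if $g,h\in G$, $x\in X_{h^{-1}}$ and $\alpha_h(x)\in X_{g^{-1}}$, then $x\in X_{(gh)^{-1}}$ and $\alpha_{gh}(x)=\alpha_g(\alpha_h(x))$. It is global if $X_g=X$ for every $g\in G$. It is free if, whenever $x\in X_{g^{-1}}\cap X_{h^{-1}}$ and $\alpha_g(x)=\alpha_h(x)$, one has $g=h$. Its orbit equivalence relation is: $i\sim_\alpha j$ if and only if $\alpha_g(j)=i$ for some $g\in G$ with $j\in X_{g^{-1}}$. $\mathcal{A}(\rho,G)$ is the set of all free partial actions of $G$ on $\overline{n}$ whose orbit equivalence relation is $\rho$. The bijection $\Phi:\mathcal{G}(\rho,G,R)\to\mathcal{A}(\rho,G)$. For $\mathcal{S}=(S_g)_{g\in G}\in\mathcal{G}(\rho,G,R)$ and $g\in G$ put $\rho_g^{\mathcal{S}}=\{(i,j)\in\rho\mid e_{i,j}\in S_g\}$ and $X_g^{\mathcal{S}}=\{i\in\overline{n}\mid (i,j)\in\rho_g^{\mathcal{S}}\text{ for some }j\in\overline{n}\}$, and let $\alpha_g^{\mathcal{S}}:X_{g^{-1}}^{\mathcal{S}}\to X_g^{\mathcal{S}}$ be given by $\alpha_g^{\mathcal{S}}(j)=i\Leftrightarrow(i,j)\in\rho_g^{\mathcal{S}}$;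 then $\Phi(\mathcal{S}):=(X_g^{\mathcal{S}},\alpha_g^{\mathcal{S}})_{g\in G}$. *)

(* Defs.v *)
From HB Require Import structures.
From mathcomp Require Import all_boot all_order all_algebra.
From mathcomp Require Import all_classical.

Set Implicit Arguments.
Unset Strict Implicit.
Unset Printing Implicit Defensive.

Import GRing.Theory.
Local Open Scope classical_set_scope.
Local Open Scope ring_scope.

(* [groupType] is an arbitrary, possibly infinite, group;
   [nzRingType] is a nonzero associative unital, not necessarily commutative,
   ring. *)

Section RingGradings.
Variables (G : groupType) (A : pzRingType).
Implicit Types (X Y B : set A) (S : G -> set A).

Definition is_addgroup X : Prop :=
  X 0 /\ forall x y, X x -> X y -> X (x - y).

Definition addgroup_mul X Y : set A :=
  smallest is_addgroup [set x * y | x in X & y in Y].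

(* The finite sums are indexed by duplicate-free lists because [G] may be
   infinite. *)
Definition is_direct_sum B S : Prop :=
  [/\ forall g, is_addgroup (S g),
      forall b, B b <-> exists (s : seq G) (f : G -> A),
        [/\ uniq s, forall g, S g (f g) & b = \sum_(g <- s) f g]
    & forall (s : seq G) (f : G -> A), uniq s -> (forall g, S g (f g)) ->
        \sum_(g <- s) f g = 0 -> forall g, g \in s -> f g = 0].

Definition ring_grading B S : Prop :=
  is_direct_sum B S /\
  forall g h, addgroup_mul (S g) (S h) `<=` S (g * h)%g.

Definition strong S : Prop :=
  forall g, addgroup_mul (S g) (S g^-1%g) = S 1%g.

End RingGradings.

Section RelationGradings.
Variables (G : groupType) (T : Type).
Implicit Types (X Y rho : set (T * T)).

Definition rel_mul X Y : set (T * T) :=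
  [set p | exists j, X (p.1, j) /\ Y (j, p.2)].

Definition rel_grading rho (rho_ : G -> set (T * T)) : Prop :=
  [/\ forall g h, g != h -> rho_ g `&` rho_ h = set0,
      rho = \bigcup_g rho_ g
    & forall g h, rel_mul (rho_ g) (rho_ h) `<=` rho_ (g * h)%g].

Definition is_equivalence rho : Prop :=
  [/\ forall i, rho (i, i),
      forall i j, rho (i, j) -> rho (j, i)
    & forall i j k, rho (i, j) -> rho (j, k) -> rho (i, k)].

End RelationGradings.

Section MatrixGradings.
Variables (R : nzRingType) (n : nat).
Implicit Types (rho Y : set ('I_n * 'I_n)).

Definition Mrel Y : set 'M[R]_n :=
  [set M | exists c : 'I_n -> 'I_n -> R,
     M = \sum_(p : 'I_n * 'I_n | p \in Y) c p.1 p.2 *: delta_mx p.1 p.2].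

Definition very_good (G : groupType) rho (S : G -> set 'M[R]_n) : Prop :=
  ring_grading (Mrel rho) S /\
  exists2 rho_, rel_grading rho rho_ & forall g, S g = Mrel (rho_ g).

Definition very_good_gradings (G : groupType) rho : set (G -> set 'M[R]_n) :=
  [set S | very_good rho S /\ S 1%g = Mrel [set p | p.1 = p.2]].

End MatrixGradings.
Arguments Mrel R {n} Y.
Arguments very_good_gradings R {n} G rho.

(* [pact g] is a total function of which only the restriction to
   [pdom g^-1] is meaningful. *)
Record partial_action (G : groupType) (T : Type) := PartialAction {
  pdom : G -> set T;
  pact : G -> T -> T;
  pact_bij : forall g, set_bij (pdom g^-1%g) (pdom g) (pact g);
  pact1 : pdom 1%g = setT /\ forall x, pact 1%g x = x;
  pactM : forall g h x, pdom h^-1%g x -> pdom g^-1%g (pact h x) ->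
    pdom (g * h)^-1%g x /\ pact (g * h)%g x = pact g (pact h x) }.

Section PartialActions.
Variables (G : groupType) (T : Type).
Implicit Types (a : partial_action G T) (rho : set (T * T)).

Definition is_global a : Prop := forall g, pdom a g = setT.

Definition is_free a : Prop :=
  forall g h x, pdom a g^-1%g x -> pdom a h^-1%g x ->
    pact a g x = pact a h x -> g = h.

Definition orbit_rel a : set (T * T) :=
  [set p | exists2 g, pdom a g^-1%g p.2 & pact a g p.2 = p.1].

Definition free_partial_actions rho : set (partial_action G T) :=
  [set a | is_free a /\ orbit_rel a = rho].

End PartialActions.
Arguments free_partial_actions G {T} rho.

Section Phi.
Variables (R : nzRingType) (n : nat) (G : groupType).
Variable rho : set ('I_n * 'I_n).
Implicit Types (S : G -> set 'M[R]_n) (i j k : 'I_n).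

Definition rho_of S g : set ('I_n * 'I_n) :=
  [set p | rho p /\ S g (delta_mx p.1 p.2)].

Definition X_of S g : set 'I_n := [set i | exists j, rho_of S g (i, j)].

(* [xget] picks the (unique) [i] such that [rho_of S g (i, j)]; outside
   [X_of S g^-1] there is none and the value is the junk [j]. *)
Definition alpha_of S g j : 'I_n := xget j [set i | rho_of S g (i, j)].

Lemma Mrel_delta (Y : set ('I_n * 'I_n)) i j :
  Mrel R Y (delta_mx i j) <-> Y (i, j).
Proof.
split=> [[c]|Yij].
  move=> /(congr1 (fun M : 'M_n => M i j)); rewrite mxE !eqxx summxE.
  have [/set_mem //|nY] := boolP ((i, j) \in Y).
  rewrite big1 => [/eqP|[k l] /= Ykl]; first by rewrite oner_eq0.
  rewrite !mxE; case: eqVneq => [ik|_]; last by rewrite mulr0.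
  case: eqVneq => [jl|_]; last by rewrite mulr0.
  by move: nY; rewrite ik jl Ykl.
exists (fun k l => ((k, l) == (i, j))%:R).
rewrite (bigD1 (i, j)) ?mem_set //= eqxx scale1r big1 ?addr0 // => -[k l] /=.
by move=> /andP[_ /negbTE ->]; rewrite scale0r.
Qed.

Section Facts.
Hypothesis rhoE : is_equivalence rho.
Variable S : G -> set 'M[R]_n.
Hypothesis HS : very_good_gradings R G rho S.

Let r_ := rho_of S.

Lemma rho_of_grading : rel_grading rho r_.
Proof.
case: HS => -[_ [rho_ [H1 H2 H3] SE]] _.
suff -> : r_ = rho_ by [].
apply/funext => g; apply/seteqP; rewrite /r_ /rho_of.
split=> -[i j] /=; rewrite SE Mrel_delta; first by case.
by move=> h; split=> //; rewrite H2; exists g.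
Qed.

Lemma rho_of1 i j : r_ 1%g (i, j) <-> i = j.
Proof.
case: HS => _ S1; rewrite /r_ /rho_of /= S1 Mrel_delta /=.
by split=> [[]//|<-]; split=> //; case: rhoE.
Qed.

Lemma rho_ofM g h i j k :
  r_ g (i, j) -> r_ h (j, k) -> r_ (g * h)%g (i, k).
Proof.
by case: rho_of_grading => _ _ rM gij hjk; apply: rM; exists j.
Qed.

Lemma rho_of_inj g h i j : r_ g (i, j) -> r_ h (i, j) -> g = h.
Proof.
case: rho_of_grading => rD _ _ gij hij; apply/eqP/negPn/negP => /rD E.
suff: (r_ g `&` r_ h) (i, j) by rewrite E.
by split.
Qed.

Lemma rho_of_sub g i j : r_ g (i, j) -> rho (i, j).
Proof. by case. Qed.

Lemma rho_of_ex i j : rho (i, j) -> exists g, r_ g (i, j).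
Proof.
by case: rho_of_grading => _ rU _; rewrite {1}rU => -[g _ gij]; exists g.
Qed.

Lemma rho_ofV g i j : r_ g (i, j) <-> r_ g^-1%g (j, i).
Proof.
suff h g' i' j' : r_ g' (i', j') -> r_ g'^-1%g (j', i').
  by split=> /h //; rewrite invgK.
move=> gij; have [_ rs _] := rhoE.
have [k kji] := rho_of_ex (rs _ _ (rho_of_sub gij)).
have e : (k * g' = 1)%g.
  by apply: (rho_of_inj (rho_ofM kji gij)); apply/rho_of1.
by have <- : k = g'^-1%g by apply: (mulIg g'); rewrite e mulVg.
Qed.

Lemma rho_of_funl g i i' j : r_ g (i, j) -> r_ g (i', j) -> i = i'.
Proof.
move=> gij /rho_ofV gji'; apply/rho_of1.
by rewrite -(mulgV g); apply: rho_ofM gij gji'.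
Qed.

Lemma rho_of_funr g i j j' : r_ g (i, j) -> r_ g (i, j') -> j = j'.
Proof. by move=> /rho_ofV h /rho_ofV h'; apply: rho_of_funl h h'. Qed.

Lemma X_ofV g j : X_of S g^-1%g j <-> exists i, r_ g (i, j).
Proof.
by split=> -[i h]; exists i; [apply/rho_ofV|rewrite -/r_ -rho_ofV].
Qed.

Lemma alpha_ofE g i j :
  X_of S g^-1%g j -> (alpha_of S g j = i <-> rho_of S g (i, j)).
Proof.
move=> /X_ofV h; have /= h' := xgetPex j h; split=> [<- //|].
exact: rho_of_funl h'.
Qed.

Lemma alpha_ofP g j :
  X_of S g^-1%g j -> rho_of S g (alpha_of S g j, j).
Proof. by move=> h; apply/(alpha_ofE _ h). Qed.

Lemma alpha_of_bij g :
  set_bij (X_of S g^-1%g) (X_of S g) (alpha_of S g).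
Proof.
split.
- by move=> j /alpha_ofP h; exists j.
- move=> j j' /set_mem/alpha_ofP h /set_mem/alpha_ofP h' e.
  by move: h; rewrite e => h; apply: rho_of_funr h h'.
- move=> i [j gij]; have Xj : X_of S g^-1%g j by apply/X_ofV; exists i.
  by exists j => //; apply/alpha_ofE.
Qed.

Lemma alpha_of1 :
  X_of S 1%g = setT /\ forall j, alpha_of S 1%g j = j.
Proof.
have X1 : X_of S 1%g = setT.
  by apply/seteqP; split=> // i _; exists i; apply/rho_of1.
by split=> // j; apply/alpha_ofE; [rewrite invg1 X1|apply/rho_of1].
Qed.

Lemma alpha_ofM g h j :
  X_of S h^-1%g j -> X_of S g^-1%g (alpha_of S h j) ->
  X_of S (g * h)^-1%g j /\
  alpha_of S (g * h)%g j = alpha_of S g (alpha_of S h j).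
Proof.
move=> /alpha_ofP hj /alpha_ofP ghj; have r := rho_ofM ghj hj.
have X : X_of S (g * h)^-1%g j by apply/X_ofV; eexists; exact: r.
by split=> //; apply/alpha_ofE.
Qed.

Definition Phi_action : partial_action G 'I_n :=
  PartialAction alpha_of_bij alpha_of1 alpha_ofM.

Lemma Phi_action_free_orbit : free_partial_actions G rho Phi_action.
Proof.
split.
- move=> g h j /alpha_ofP gj /alpha_ofP hj /= e.
  by move: gj; rewrite e => gj; apply: rho_of_inj gj hj.
- apply/seteqP; split=> -[i j].
    by move=> [g /alpha_ofP gj /= e]; move: gj; rewrite e; case.
  move=> /rho_of_ex[g gij].
  have X : X_of S g^-1%g j by apply/X_ofV; exists i.
  by exists g => //=; apply/alpha_ofE.
Qed.

End Facts.

Definition Phi (rhoE : is_equivalence rho) (S : very_good_gradings R G rho) :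
    free_partial_actions G rho :=
  SigSub (mem_set (Phi_action_free_orbit rhoE (set_mem (valP S)))).

End Phi.

(* Main.v *)
(* [S_g S_{g^-1}] is contained in [S_e] for any grading.  If [i] lies in [X_g],
   say [(i, j)] is in [rho_g], then [r e_ii = (r e_ij) e_ji] is in
   [S_g S_{g^-1}]; if it does not, every matrix in [S_g S_{g^-1}] has a zero
   [i]-th row, hence [e_ii] is not one of them.  So [S_g S_{g^-1} = S_e] iff
   [X_g] is everything. *)
Require Import Defs.
From HB Require Import structures.
From mathcomp Require Import all_boot all_order all_algebra.
From mathcomp Require Import all_classical.

Set Implicit Arguments.
Unset Strict Implicit.
Unset Printing Implicit Defensive.

Import GRing.Theory.
Local Open Scope classical_set_scope.
Local Open Scope ring_scope.

Section AdditiveSubgroups.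
Variable A : pzRingType.
Implicit Types X Y : set A.

Lemma is_addgroupD X x y : is_addgroup X -> X x -> X y -> X (x + y).
Proof.
move=> [X0 XB] Xx Xy; rewrite -[y]opprK; apply: (XB _ _ Xx).
by rewrite -[- y]sub0r; apply: XB.
Qed.

Lemma is_addgroup_sum X (I : Type) (r : seq I) (P : pred I) (F : I -> A) :
  is_addgroup X -> (forall i, P i -> X (F i)) -> X (\sum_(i <- r | P i) F i).
Proof.
move=> gX XF; apply: (big_ind X) => // [|x y]; first by case: gX.
exact: is_addgroupD.
Qed.

(** An intersection of additive subgroups is again one. *)
Lemma addgroup_mul_is_addgroup X Y : is_addgroup (addgroup_mul X Y).
Proof.
split=> [Z [[]]//|x y Xx Xy Z [gZ XYZ]].
by case: (gZ) => _; apply; [apply: Xx|apply: Xy].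
Qed.

Lemma addgroup_mulM X Y x y : X x -> Y y -> addgroup_mul X Y (x * y).
Proof. by move=> Xx Yy Z [_]; apply; exists x => //; exists y. Qed.

End AdditiveSubgroups.

Section MatrixSpans.
Variables (R : nzRingType) (n : nat).
Implicit Types Y Z : set ('I_n * 'I_n).

Lemma MrelZ_delta Y i j (r : R) : Y (i, j) -> Mrel R Y (r *: delta_mx i j).
Proof.
move=> Yij; exists (fun k l => if (k, l) == (i, j) then r else 0).
rewrite (bigD1 (i, j)) ?mem_set //= eqxx big1 ?addr0 // => -[k l] /=.
by move=> /andP[_ /negbTE ->]; rewrite scale0r.
Qed.

Lemma Mrel_row0 Y i k (M : 'M[R]_n) :
  (forall j, ~ Y (i, j)) -> Mrel R Y M -> M i k = 0.
Proof.
move=> nY [c ->]; rewrite summxE big1 // => -[a b] /set_mem Yab.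
rewrite !mxE /=; case: eqVneq => [ia|_]; last by rewrite mulr0.
by case: (nY b); rewrite ia.
Qed.

(** Matrices with zero [(i, k)] entry form an additive subgroup. It contains all the generating
    products, because row [i] of the left factor vanishes; hence it contains the subgroup they
    generate. *)
Lemma addgroup_mul_Mrel_row0 Y (X : set 'M[R]_n) i k (M : 'M[R]_n) :
  (forall j, ~ Y (i, j)) -> addgroup_mul (Mrel R Y) X M -> M i k = 0.
Proof.
move=> nY; apply: (_ : addgroup_mul _ _ `<=` [set N : 'M[R]_n | N i k = 0]).
apply: smallest_sub => [|_ [x Yx [y _ <-]]] /=.
  by split=> /= [|x y Ex Ey]; rewrite !mxE // Ex Ey subr0.
by rewrite mxE big1 // => j _; rewrite (Mrel_row0 _ nY Yx) mul0r.
Qed.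

Lemma diag_sub_addgroup_mul_Mrel Y Z :
  (forall i, exists2 j, Y (i, j) & Z (j, i)) ->
  Mrel R [set p | p.1 = p.2] `<=` addgroup_mul (Mrel R Y) (Mrel R Z).
Proof.
move=> YZ _ [c ->]; apply: is_addgroup_sum => [|[i k] /set_mem /= <-].
  exact: addgroup_mul_is_addgroup.
have [j Yij Zji] := YZ i.
(* Factor [e_ii] through [j] as [e_ij e_ji], attaching the coefficient to the left factor. *)
rewrite -(mul_delta_mx j i i) scalemxAl.
by apply: addgroup_mulM; [apply: MrelZ_delta|apply/Mrel_delta].
Qed.

End MatrixSpans.

(** Very goodness only provides some grading of [rho] spanning [S]. It is determined by [S], as
    [e_ij] lies in [Mrel R Y] exactly when [(i, j)] is in [Y]; so it can be replaced by [rho_of],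
    from which [Phi] is built. *)
Lemma very_good_gradingE (R : nzRingType) (n : nat) (G : groupType)
    (rho : set ('I_n * 'I_n)) (S : G -> set 'M[R]_n) g :
  very_good_gradings R G rho S -> S g = Mrel R (rho_of rho S g).
Proof.
case=> -[_ [rho_ [_ rU _] SE]] _; rewrite SE; congr Mrel.
apply/seteqP; rewrite /rho_of; split=> -[i j] /=; rewrite SE Mrel_delta.
  by move=> h; split=> //; rewrite rU; exists g.
by case.
Qed.

Theorem corollary38 (R : nzRingType) (n : nat) (n_gt0 : (0 < n)%N)
    (G : groupType) (rho : set ('I_n * 'I_n)) (rhoE : is_equivalence rho)
    (S : very_good_gradings R G rho) :
  strong (val S) <-> is_global (val (Phi rhoE S)).
Proof.
have HS := set_mem (valP S); have SE g := very_good_gradingE g HS.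
have [[[_ SM] _] S1] := HS.
split=> [strongS g|globalS g].
  apply/seteqP; split=> // i _; apply: contrapT => nXi.
  have nrho j : ~ rho_of rho (val S) g (i, j).
    by move=> gij; apply: nXi; exists j.
  (* The test matrix is [e_ii]: its [(i, i)] entry is 1, which is nonzero in [R], while strongness
     would force it to be 0. *)
  have : val S 1%g (delta_mx i i) by rewrite S1; apply/Mrel_delta.
  rewrite -(strongS g) (SE g) => /(addgroup_mul_Mrel_row0 i nrho)/eqP.
  by rewrite mxE !eqxx oner_eq0.
apply/seteqP; split; first by rewrite -(mulgV g); apply: SM.
rewrite S1 (SE g) (SE g^-1%g); apply: diag_sub_addgroup_mul_Mrel => i.
have [j gij] : X_of rho (val S) g i by have /= -> := globalS g.
(* Inverting the degree transposes the pair, so [(j, i)] has degree [g^-1]. *)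
by exists j => //; apply: (rho_ofV rhoE HS g i j).1.
Qed.
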